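(* Consider the fully-discrete path-conservative discontinuous Galerkin method for the one-dimensional two-layer shallow water equations, formulated in the equilibrium variables $\boldsymbol v=(E_1,m_1,E_2,m_2,b)^T\in\boldsymbol{\mathcal V}_h^k$, consisting of the space discretization with operator $\mathrm{RHS}^M_j$ defined in the context together with the third-order strong stability preserving Runge–Kutta time discretization: for every cell $\mathcal I_j$ and every test function $\boldsymbol\varphi\in\boldsymbol{\mathcal V}_h^k$, $$\int_{\mathcal I_j}\boldsymbol u(\boldsymbol v^{(1)})\cdot\boldsymbol\varphi\,dx=\int_{\mathcal I_j}\boldsymbol u(\boldsymbol v^n)\cdot\boldsymbol\varphi\,dx+\Delta t\,\mathrm{RHS}^M_j(\boldsymbol v^n,\boldsymbol\varphi),$$ $$\int_{\mathcal I_j}\boldsymbol u(\boldsymbol v^{(2)})\cdot\boldsymbol\varphi\,dx=\tfrac34\int_{\mathcal I_j}\boldsymbol u(\boldsymbol v^n)\cdot\boldsymbol\varphi\,dx+\tfrac14\Big(\int_{\mathcal I_j}\boldsymbol u(\boldsymbol v^{(1)})\cdot\boldsymbol\varphi\,dx+\Delta t\,\mathrm{RHS}^M_j(\boldsymbol v^{(1)},\boldsymbol\varphi)\Big),$$ $$\int_{\mathcal I_j}\boldsymbol u(\boldsymbol v^{n+1})\cdot\boldsymbol\varphi\,dx=\tfrac13\int_{\mathcal I_j}\boldsymbol u(\boldsymbol v^n)\cdot\boldsymbol\varphi\,dx+\tfrac23\Big(\int_{\mathcal I_j}\boldsymbol u(\boldsymbol v^{(2)})\cdot\boldsymbol\varphi\,dx+\Delta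 t\,\mathrm{RHS}^M_j(\boldsymbol v^{(2)},\boldsymbol\varphi)\Big).$$ This method is exact for the one-dimensional moving water equilibrium state $$E_1=\text{constant},\quad m_1=\text{constant},\quad E_2=\text{constant},\quad m_2=\text{constant};$$ that is, if the initial data are in an exact moving water equilibrium state, the fully-discrete method preserves that state exactly: $\boldsymbol v^n=\boldsymbol v^0$ for all $n\ge0$.
   Context: **Equations and variables.** $g$ is the gravitational acceleration and $r<1$ the density ratio of the upper layer (index 1) to the lower layer (index 2). $h_i$ are the layer thicknesses, $u_i$ the depth-averaged velocities, $m_i=h_iu_i$ the discharges, and $b$ the bottom topography. With the added trivial equation $b_t=0$, the conservative variables are $\boldsymbol u=(h_1,m_1,h_2,m_2,b)^T$ and the two-layer shallow water system is $\boldsymbol u_t+\boldsymbol f(\boldsymbol u)_x+\mathcal G(\boldsymbol u)\boldsymbol u_x=0$, where $$\boldsymbol f(\boldsymbol u)=\Big(m_1,\ \tfrac{m_1^2}{h_1}+\tfrac12gh_1^2,\ m_2,\ \tfrac{m_2^2}{h_2}+\tfrac12gh_2^2,\ 0\Big)^T$$ and $\mathcal G(\boldsymbol u)$ is the $5\times5$ matrix whose only nonzero entries are $\mathcal G_{23}=\mathcal G_{25}=gh_1$, $\mathcal G_{41}=grh_2$, $\mathcal G_{45}=gh_2$. The energies are $$E_1=\tfrac12u_1^2+g(h_1+h_2+b),\qquad E_2=\tfrac12u_2^2+g(rh_1+h_2+b).$$ Put $\boldsymbol v=(E_1,m_1,E_2,m_2,b)^T$ and $\widetilde{\boldsymbol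 v}=(E_1,m_1,E_2,m_2,0)^T$. Then $\boldsymbol f(\boldsymbol u)_x+\mathcal G(\boldsymbol u)\boldsymbol u_x=\mathcal L(\boldsymbol u)\widetilde{\boldsymbol v}(\boldsymbol u)_x$ with $$\mathcal L(\boldsymbol u)=\begin{pmatrix}0&1&0&0&0\\ h_1&u_1&0&0&0\\ 0&0&0&1&0\\ 0&0&h_2&u_2&0\\ 0&0&0&0&1\end{pmatrix}.$$ **Inverse transform.** $\boldsymbol u(\boldsymbol v)$ denotes the inverse of the transform $\boldsymbol u\mapsto\boldsymbol v$: $m_1,m_2,b$ are unchanged, and $(h_1,h_2)$ is obtained from $$Q_1=gh_1^3+(g(h_2+b)-E_1)h_1^2+\tfrac12m_1^2=0,\qquad Q_2=gh_2^3+(g(rh_1+b)-E_2)h_2^2+\tfrac12m_2^2=0,$$ solved in general by Newton iteration. The nonlinear systems arising at each Runge–Kutta stage are solved by Newton's method locally in each cell. **Mesh and spaces.** The domain is divided into cells $\mathcal I_j=[x_{j-\frac12},x_{j+\frac12}]$, $j=1,\dots,nx$; $\Delta t$ is the time step and $\boldsymbol v^n$ the numerical solution after $n$ steps. $\mathcal W_h^k$ is the space of functions that are polynomials of degree at most $k$ on each cell, and $\boldsymbol{\mathcal V}_h^k$ is the space of 5-component vectors with components in $\mathcal W_h^k$. The superscripts $-,+$ denote left and right limits at an interface, and $\boldsymbol u^\pm_{j+\frac12}=\boldsymbol u(\boldsymbol v^\pm_{j+\frac12})$. **Spatial operator.** $$\begin{aligned}\mathrm{RHS}^M_j(\boldsymbol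 v,\boldsymbol\varphi)=&\int_{\mathcal I_j}\boldsymbol f(\boldsymbol u(\boldsymbol v))\cdot\boldsymbol\varphi_x\,dx-\widehat{\boldsymbol f}^{\rm mod}_{j+\frac12}\cdot\boldsymbol\varphi^-_{j+\frac12}+\widehat{\boldsymbol f}^{\rm mod}_{j-\frac12}\cdot\boldsymbol\varphi^+_{j-\frac12}\\ &-\int_{\mathcal I_j}\mathcal G(\boldsymbol u(\boldsymbol v))\,\boldsymbol u(\boldsymbol v)_x\cdot\boldsymbol\varphi\,dx-\tfrac12\boldsymbol\varphi^-_{j+\frac12}\cdot\boldsymbol{\mathfrak g}_{j+\frac12}-\tfrac12\boldsymbol\varphi^+_{j-\frac12}\cdot\boldsymbol{\mathfrak g}_{j-\frac12}.\end{aligned}$$ In the cell integral of the nonconservative product, $\boldsymbol u(\boldsymbol v)_x$ is evaluated by the chain rule, with the derivatives of $h_1,h_2$ with respect to $\boldsymbol v$ obtained from $Q_1=Q_2=0$ by the implicit function theorem. *Modified flux:* $$\widehat{\boldsymbol f}^{\rm mod}_{j+\frac12}=\tfrac12\big(\boldsymbol f(\boldsymbol u^-_{j+\frac12})+\boldsymbol f(\boldsymbol u^+_{j+\frac12})\big)-\tfrac\alpha2\big(\boldsymbol u^{*,+}_{j+\frac12}-\boldsymbol u^{*,-}_{j+\frac12}\big),$$ where $\alpha$ is the maximum over $\boldsymbol u$ of the absolute values of the eigenvalues of $\partial\boldsymbol f/\partial\boldsymbol u$, $b^*_{j+\frac12}=\min(b^-_{j+\frac12},b^+_{j+\frac12})$,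 and $\boldsymbol u^{*,\pm}_{j+\frac12}=\big((h_1)^{*,\pm}_{j+\frac12},(m_1)^\pm_{j+\frac12},(h_2)^{*,\pm}_{j+\frac12},(m_2)^\pm_{j+\frac12},b^*_{j+\frac12}\big)^T$, with $(h_1)^{*,\pm},(h_2)^{*,\pm}$ solving (index $j+\frac12$ omitted) $$E_1^\pm=\frac{(m_1^\pm)^2}{2(h_1^{*,\pm})^2}+g(h_1^{*,\pm}+h_2^{*,\pm}+b^* ),\qquad E_2^\pm=\frac{(m_2^\pm)^2}{2(h_2^{*,\pm})^2}+g(rh_1^{*,\pm}+h_2^{*,\pm}+b^* ).$$ *Path-integral term:* $$\boldsymbol{\mathfrak g}_{j+\frac12}=\int_0^1\mathcal L(\boldsymbol\phi_{j+\frac12}(\tau))\,\frac{\partial}{\partial\tau}\widetilde{\boldsymbol v}(\boldsymbol\phi_{j+\frac12}(\tau))\,d\tau-\boldsymbol f(\boldsymbol u^+_{j+\frac12})+\boldsymbol f(\boldsymbol u^-_{j+\frac12}),$$ where the left and right states are connected by the linear segment path applied to the equilibrium functions, $\boldsymbol\phi_{j+\frac12}(\tau)=\widetilde{\boldsymbol v}^-_{j+\frac12}+\tau(\widetilde{\boldsymbol v}^+_{j+\frac12}-\widetilde{\boldsymbol v}^-_{j+\frac12})$. The integral thus becomes $\int_0^1\mathcal L(\boldsymbol\phi_{j+\frac12}(\tau))(\widetilde{\boldsymbol v}^+_{j+\frac12}-\widetilde{\boldsymbol v}^-_{j+\frac12})\,d\tau$, which is evaluated numerically, e.g. by Simpson's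 formula. *)

(* Defs.v *)
From HB Require Import structures.
From mathcomp Require Import all_boot all_order all_algebra.
From mathcomp Require Import all_classical all_reals all_analysis.
From mathcomp Require Import ring.
Set Implicit Arguments. Unset Strict Implicit. Unset Printing Implicit Defensive.
Import Order.TTheory GRing.Theory Num.Theory.
Import numFieldNormedType.Exports.
Local Open Scope classical_set_scope.
Local Open Scope ring_scope.

(* States are row vectors of length 5, so a matrix M of the paper acts on the
   right through its transpose: the paper's M w is [w *m M^T] here.
   Conservative states are (h1, m1, h2, m2, b), equilibrium states are
   (E1, m1, E2, m2, b). *)
Definition row5 (R : Type) (x0 x1 x2 x3 x4 : R) : 'rV[R]_5 :=
  \row_i nth x4 [:: x0; x1; x2; x3] i.

Definition i0 : 'I_5 := @Ordinal 5 0 isT.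
Definition i1 : 'I_5 := @Ordinal 5 1 isT.
Definition i2 : 'I_5 := @Ordinal 5 2 isT.
Definition i3 : 'I_5 := @Ordinal 5 3 isT.
Definition i4 : 'I_5 := @Ordinal 5 4 isT.

Definition dot (R : realType) (a c : 'rV[R]_5) : R := \sum_i a 0 i * c 0 i.

Definition tilde (R : realType) (v : 'rV[R]_5) : 'rV[R]_5 :=
  row5 (v 0 i0) (v 0 i1) (v 0 i2) (v 0 i3) 0.

(* A 5-component polynomial and its pointwise value and derivative. *)
Definition ev (R : realType) (p : 'rV[{poly R}]_5) (x : R) : 'rV[R]_5 :=
  \row_i (p 0 i).[x].

Definition dpoly (R : realType) (p : 'rV[{poly R}]_5) : 'rV[{poly R}]_5 :=
  \row_i (p 0 i)^`().

(* The data of one instance of the method.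
   [height] is the selected solution branch (h1, h2) of Q1 = Q2 = 0 as a
   function of the equilibrium state (E1, m1, E2, m2, b).
   Cells and nodes are numbered from 0.  A piecewise polynomial is the family
   of its restrictions to the cells; [ghostL] and [ghostR] give the exterior
   traces at the two ends of the domain, as functions of the numerical solution
   (boundary condition).
   [quad] is the rule for the path integral over [0, 1]: [None] is the exact
   integral, [Some q] the quadrature with (weight, node) pairs q, for instance
   [:: (1/6, 0); (2/3, 1/2); (1/6, 1)] for Simpson's formula. *)
Record method (R : realType) := Method {
  grav : R;
  density_ratio : R;
  height : 'rV[R]_5 -> 'rV[R]_2;
  ncell : nat;
  node : 'I_ncell.+1 -> R;
  degree : nat;
  dt : R;
  ghostL : ('I_ncell -> 'rV[{poly R}]_5) -> 'rV[R]_5;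
  ghostR : ('I_ncell -> 'rV[{poly R}]_5) -> 'rV[R]_5;
  quad : option (seq (R * R)) }.

Definition field5 (R : realType) (S : method R) : Type :=
  'I_(ncell S) -> 'rV[{poly R}]_5.

Section TwoLayer.
Context (R : realType) (S : method R).
Let g : R := grav S.
Let r : R := density_ratio S.

Definition flux (u : 'rV[R]_5) : 'rV[R]_5 :=
  let h1 := u 0 i0 in let m1 := u 0 i1 in
  let h2 := u 0 i2 in let m2 := u 0 i3 in
  row5 m1 (m1 ^+ 2 / h1 + g * h1 ^+ 2 / 2)
       m2 (m2 ^+ 2 / h2 + g * h2 ^+ 2 / 2) 0.

Definition Gmx (u : 'rV[R]_5) : 'M[R]_5 :=
  let h1 := u 0 i0 in let h2 := u 0 i2 in
  (g * h1) *: (delta_mx i1 i2 + delta_mx i1 i4)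
  + (g * r * h2) *: delta_mx i3 i0 + (g * h2) *: delta_mx i3 i4.

Definition Lmx (u : 'rV[R]_5) : 'M[R]_5 :=
  let h1 := u 0 i0 in let m1 := u 0 i1 in
  let h2 := u 0 i2 in let m2 := u 0 i3 in
  delta_mx i0 i1 + h1 *: delta_mx i1 i0 + (m1 / h1) *: delta_mx i1 i1
  + delta_mx i2 i3 + h2 *: delta_mx i3 i2 + (m2 / h2) *: delta_mx i3 i3
  + delta_mx i4 i4.

(* The transform from conservative to equilibrium variables. *)
Definition equil (u : 'rV[R]_5) : 'rV[R]_5 :=
  let h1 := u 0 i0 in let m1 := u 0 i1 in
  let h2 := u 0 i2 in let m2 := u 0 i3 in let b := u 0 i4 in
  row5 ((m1 / h1) ^+ 2 / 2 + g * (h1 + h2 + b)) m1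
       ((m2 / h2) ^+ 2 / 2 + g * (r * h1 + h2 + b)) m2 b.

Definition consv (v : 'rV[R]_5) : 'rV[R]_5 :=
  row5 (height S v 0 0) (v 0 i1) (height S v 0 1) (v 0 i3) (v 0 i4).

Definition Q (h : 'rV[R]_2) (v : 'rV[R]_5) : 'rV[R]_2 :=
  let h1 := h 0 0 in let h2 := h 0 1 in
  let E1 := v 0 i0 in let m1 := v 0 i1 in
  let E2 := v 0 i2 in let m2 := v 0 i3 in let b := v 0 i4 in
  \row_i nth 0
    [:: g * h1 ^+ 3 + (g * (h2 + b) - E1) * h1 ^+ 2 + m1 ^+ 2 / 2;
        g * h2 ^+ 3 + (g * (r * h1 + b) - E2) * h2 ^+ 2 + m2 ^+ 2 / 2] i.

Definition Qh (h : 'rV[R]_2) (v : 'rV[R]_5) : 'M[R]_2 :=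
  jacobian (fun h' : 'rV[R]_2 => Q h' v) h.

Definition Qv (h : 'rV[R]_2) (v : 'rV[R]_5) : 'M[R]_(5, 2) :=
  jacobian (fun v' : 'rV[R]_5 => Q h v') v.

(* Implicit function theorem: dh *m Qh + dv *m Qv = 0. *)
Definition dheight (v : 'rV[R]_5) : 'M[R]_(5, 2) :=
  - Qv (height S v) v *m invmx (Qh (height S v) v).

(* The derivative of u(v) in the direction w. *)
Definition dconsv (v w : 'rV[R]_5) : 'rV[R]_5 :=
  let dh := w *m dheight v in
  row5 (dh 0 0) (w 0 i1) (dh 0 1) (w 0 i3) (w 0 i4).

(* On D, [consv] is an inverse of [equil] with positive layer thicknesses; it
   depends continuously on v and the implicit function theorem applies to
   Q = 0.  Several branches may exist (subcritical, supercritical). *)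
Definition inverse_transform (D : set 'rV[R]_5) : Prop :=
  {within D, continuous (height S)} /\
  forall v, D v ->
    [/\ 0 < height S v 0 0, 0 < height S v 0 1,
        equil (consv v) = v & Qh (height S v) v \in unitmx].

Definition inV (v : field5 S) : Prop :=
  forall j i, (size (v j 0%R i) <= (degree S).+1)%N.

Definition lnode (j : 'I_(ncell S)) : R := node (lift ord_max j).
Definition rnode (j : 'I_(ncell S)) : R := node (lift ord0 j).
Definition cell (j : 'I_(ncell S)) : set R := `[lnode j, rnode j].

(* [unlift ord0 i] is the cell to the left of node i and [unlift ord_max i] the
   cell to its right, when they exist. *)
Definition trace_minus (v : field5 S) (i : 'I_(ncell S).+1) : 'rV[R]_5 :=
  if unlift ord0 i is Some j then ev (v j) (node i) else ghostL v.

Definition trace_plus (v : field5 S) (i : 'I_(ncell S).+1) : 'rV[R]_5 :=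
  if unlift ord_max i is Some j then ev (v j) (node i) else ghostR v.

Definition cell_int (j : 'I_(ncell S)) (F : R -> R) : R :=
  \int[lebesgue_measure]_(x in cell j) F x.

Definition path_int (F : R -> R) : R :=
  if quad S is Some q then \sum_(p <- q) p.1 * F p.2
  else \int[lebesgue_measure]_(x in `[0, 1]) F x.

(* The largest modulus of an eigenvalue of df/du over the states taken by the
   numerical solution. *)
Definition alpha (v : field5 S) : R :=
  sup [set a | exists j x lam, [/\ cell j x,
    eigenvalue (jacobian flux (consv (ev (v j) x))) lam & a = `|lam| ]].

Definition star (v : 'rV[R]_5) (bstar : R) : 'rV[R]_5 :=
  consv (row5 (v 0 i0) (v 0 i1) (v 0 i2) (v 0 i3) bstar).

Definition flux_mod (v : field5 S) (i : 'I_(ncell S).+1) : 'rV[R]_5 :=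
  let vm := trace_minus v i in let vp := trace_plus v i in
  let bstar := Num.min (vm 0 i4) (vp 0 i4) in
  2^-1 *: (flux (consv vm) + flux (consv vp))
  - (alpha v / 2) *: (star vp bstar - star vm bstar).

Definition path_term (v : field5 S) (i : 'I_(ncell S).+1) : 'rV[R]_5 :=
  let vm := trace_minus v i in let vp := trace_plus v i in
  let jump := tilde vp - tilde vm in
  let phi := fun tau : R => tilde vm + tau *: jump in
  (\row_c path_int (fun tau => (jump *m (Lmx (consv (phi tau)))^T) 0 c))
  - flux (consv vp) + flux (consv vm).

Definition RHS (v : field5 S) (phi : field5 S) (j : 'I_(ncell S)) : R :=
  let jl := lift ord_max j in let jr := lift ord0 j in
  let phil := ev (phi j) (lnode j) in let phir := ev (phi j) (rnode j) in
  cell_int j (fun x => dot (flux (consv (ev (v j) x))) (ev (dpoly (phi j)) x))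
  - dot (flux_mod v jr) phir + dot (flux_mod v jl) phil
  - cell_int j (fun x =>
      dot (dconsv (ev (v j) x) (ev (dpoly (v j)) x)
           *m (Gmx (consv (ev (v j) x)))^T) (ev (phi j) x))
  - 2^-1 * dot phir (path_term v jr) - 2^-1 * dot phil (path_term v jl).

Definition mass (j : 'I_(ncell S)) (p : 'rV[{poly R}]_5) (phi : field5 S) : R :=
  cell_int j (fun x => dot (consv (ev p x)) (ev (phi j) x)).

(* A stage is the cellwise nonlinear system "mass j w phi = rhs phi j for all
   phi", with unknown w. *)
Definition solves_cell (rhs : field5 S -> 'I_(ncell S) -> R) j p : Prop :=
  forall phi, inV phi -> mass j p phi = rhs phi j.

(* One Newton step from p to p'; the iteration stops once the system is
   solved. *)
Definition newton_step (rhs : field5 S -> 'I_(ncell S) -> R) j p p' : Prop :=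
  (solves_cell rhs j p /\ p' = p) \/
  [/\ ~ solves_cell rhs j p,
      forall i, (size (p' 0%R i) <= (degree S).+1)%N &
      forall phi, inV phi ->
        cell_int j (fun x => dot (dconsv (ev p x) (ev (p' - p) x)) (ev (phi j) x))
        = - (mass j p phi - rhs phi j)].

(* w solves the stage and is the limit, cell by cell and coefficient by
   coefficient, of Newton's method started at some element of [guesses]. *)
Definition stage (guesses : set (field5 S))
    (rhs : field5 S -> 'I_(ncell S) -> R) (w : field5 S) : Prop :=
  [/\ inV w, forall j, solves_cell rhs j (w j) &
    exists2 w0, guesses w0 &
    forall j, exists s : nat -> 'rV[{poly R}]_5,
      [/\ s 0 = w0 j, forall n, newton_step rhs j (s n) (s n.+1) &
          forall i l, (fun n => (s n 0 i)`_l) @ \oo --> (w j 0 i)`_l]].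

Definition rk3_step (v w : field5 S) : Prop :=
  exists v1 v2,
  [/\ stage [set v]
        (fun phi j => mass j (v j) phi + dt S * RHS v phi j) v1,
      stage [set v' | v' = v \/ v' = v1]
        (fun phi j => 3 / 4 * mass j (v j) phi
           + 1 / 4 * (mass j (v1 j) phi + dt S * RHS v1 phi j)) v2 &
      stage [set v' | [\/ v' = v, v' = v1 | v' = v2]]
        (fun phi j => 1 / 3 * mass j (v j) phi
           + 2 / 3 * (mass j (v2 j) phi + dt S * RHS v2 phi j)) w].

Definition moving_water (E1 m1 E2 m2 : R) (v : field5 S) : Prop :=
  forall j, [/\ v j 0 i0 = E1%:P, v j 0 i1 = m1%:P,
                v j 0 i2 = E2%:P & v j 0 i3 = m2%:P].

(* The boundary values carry the same equilibrium constants; their bottom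
   component is free. *)
Definition compatible_bc (E1 m1 E2 m2 : R) (v : field5 S) : Prop :=
  tilde (ghostL v) = row5 E1 m1 E2 m2 0 /\
  tilde (ghostR v) = row5 E1 m1 E2 m2 0.

End TwoLayer.

(* For positive thicknesses, inverting the transform is solving Q1 = Q2 = 0. *)
Lemma equil_consvE (R : realType) (S : method R) (v : 'rV[R]_5) :
  0 < height S v 0 0 -> 0 < height S v 0 1 ->
  equil S (consv S v) = v <-> Q S (height S v) v = 0.
Proof.
move=> h1 h2.
have n1 := lt0r_neq0 h1; have n2 := lt0r_neq0 h2.
split=> [e|e].
- have e0 := congr1 (fun w : 'rV_5 => w 0 i0) e.
  have e2 := congr1 (fun w : 'rV_5 => w 0 i2) e.
  rewrite !mxE /= in e0 e2.
  apply/rowP => -[[|[|//]] hi]; rewrite !mxE /=.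
  + by rewrite -e0; field.
  + by rewrite -e2; field.
- have e0 := congr1 (fun w : 'rV_2 => w 0 0) e.
  have e1 := congr1 (fun w : 'rV_2 => w 0 1) e.
  rewrite !mxE /= in e0 e1.
  apply/rowP => -[[|[|[|[|[|//]]]]] hi]; rewrite !mxE /= ?mxE /=;
    try by congr (v _ _); apply: val_inj.
  + have -> : v 0 (Ordinal hi) = v 0 i0 by congr (v _ _); apply: val_inj.
    apply: (mulIf (expf_neq0 2 n1)); apply/eqP; rewrite -subr_eq0 -e0.
    by apply/eqP; field.
  + have -> : v 0 (Ordinal hi) = v 0 i2 by congr (v _ _); apply: val_inj.
    apply: (mulIf (expf_neq0 2 n2)); apply/eqP; rewrite -subr_eq0 -e1.
    by apply/eqP; field.
Qed.

(* Main.v *)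
Require Import Defs.
From mathcomp Require Import all_boot all_order all_algebra.
From mathcomp Require Import all_classical all_reals all_analysis.
From mathcomp Require Import ring.
Set Implicit Arguments. Unset Strict Implicit. Unset Printing Implicit Defensive.
Import Order.TTheory GRing.Theory Num.Theory.
Import numFieldNormedType.Exports.
Local Open Scope classical_set_scope.
Local Open Scope ring_scope.

(** A moving water equilibrium is a discrete fixed point for two independent
    reasons: the spatial operator vanishes on it, and a Newton iteration that
    starts at a solution never moves.

    Spatial operator.  The traces on the two sides of a node share E1, m1, E2
    and m2, so they differ only in the bottom.  The starred states are rebuilt
    over one common bottom from these four constants, hence coincide, and the
    dissipation drops out of the modified flux, which becomes the mean of the
    two one-sided fluxes.  The path is constant, so the path term is just the
    jump of the flux; half of it turns the mean into the trace taken from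
    inside the cell ([face_minus], [face_plus]).  What is left in each cell is
    the difference between the two sides of the integration by parts of
    f(u)_x + G(u) u_x against the test function, and this expression is zero
    because E1, m1, E2 and m2 are constant ([cell_balance]).

    The integration by parts needs u to be differentiable inside the cell with
    the derivative that the method computes from the implicit function theorem,
    whereas the height branch is only assumed continuous.  Along the cell the
    heights solve two polynomial equations whose coefficients depend on the
    bottom.  Subtracting these equations at two points gives a 2 x 2 linear
    system for the difference quotients of h1 and h2, whose matrix tends to the
    (invertible) Jacobian of Q; Cramer's rule gives the limit of the quotients
    ([is_derive_heights]) and, applied at the limit system, the continuity of
    the derivatives up to the ends of the cell ([slopes_continuous]).

    Time stepping.  With a vanishing spatial operator the equilibrium solves
    each stage equation, the Runge-Kutta weights summing to one.  All initial
    guesses of the first stage are the equilibrium, so Newton's method stops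
    there at once and its limit is the equilibrium ([stage_unique]); the same
    then holds for the guesses of the second and third stages.  So the method
    selects the equilibrium even where a stage equation has other solutions. *)

(** * Coordinates *)

Lemma sum5 (R : realType) (F : 'I_5 -> R) :
  \sum_i F i = F i0 + F i1 + F i2 + F i3 + F i4.
Proof.
rewrite !big_ord_recl big_ord0 addr0 !addrA.
by do 4?[congr (_ + _)]; congr (F _); exact: val_inj.
Qed.

Lemma row5E (R : Type) (x0 x1 x2 x3 x4 : R) :
  [/\ row5 x0 x1 x2 x3 x4 0 i0 = x0, row5 x0 x1 x2 x3 x4 0 i1 = x1,
      row5 x0 x1 x2 x3 x4 0 i2 = x2, row5 x0 x1 x2 x3 x4 0 i3 = x3 &
      row5 x0 x1 x2 x3 x4 0 i4 = x4].
Proof. by rewrite !mxE. Qed.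

Lemma dot_row5 (R : realType) (x0 x1 x2 x3 x4 : R) (q : 'rV[R]_5) :
  dot (row5 x0 x1 x2 x3 x4) q =
    x0 * q 0 i0 + x1 * q 0 i1 + x2 * q 0 i2 + x3 * q 0 i3 + x4 * q 0 i4.
Proof. by rewrite /dot sum5; have [-> -> -> -> ->] := row5E x0 x1 x2 x3 x4. Qed.

Lemma mul_Gmx (R : realType) (S : method R) (u w : 'rV[R]_5) :
  w *m (Gmx S u)^T = row5 0 (grav S * u 0 i0 * (w 0 i2 + w 0 i4)) 0
    (grav S * density_ratio S * u 0 i2 * w 0 i0 + grav S * u 0 i2 * w 0 i4) 0.
Proof.
apply/rowP => -[[|[|[|[|[|//]]]]] hi];
  rewrite !mxE /= sum5 !mxE /= ?(mulr0, mul0r, addr0, add0r, mulr1) //; ring.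
Qed.

(** * The Jacobians of Q and the implicit function theorem *)

Lemma differentiable_row2 (R : realType) (n : nat) (f : 'rV[R]_n -> 'rV[R]_2)
    (a : 'rV[R]_n) :
  (forall j, differentiable (fun x => f x 0 j : R) a) -> differentiable f a.
Proof.
move=> df.
have -> : f = (fun x => f x 0 0 *: delta_mx 0 0)
            + (fun x => f x 0 1 *: delta_mx 0 1).
  apply/funext => x; rewrite [LHS]row_sum_delta big_ord_recl big_ord1.
  have -> : lift ord0 ord0 = 1 :> 'I_2 by exact: val_inj.
  by rewrite fctE.
by apply: differentiableD; apply: differentiableZl.
Qed.

Lemma is_derive_coord (R : realType) (m n : nat) (a d : 'M[R]_(m, n)) i j :
  is_derive a d (fun x : 'M[R]_(m, n) => x i j : R) (d i j).
Proof.
have d_id : derivable (@id 'M[R]_(m, n)) a d by exact: derivable_id.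
apply: DeriveDef; first by move/derivable_mxP: d_id; apply.
by rewrite -[in RHS](derive_id a d) (derive_mx d_id) mxE.
Qed.

Lemma mul_jacobian_coord (R : realType) (n : nat) (f : 'rV[R]_n -> 'rV[R]_2)
    (a d : 'rV[R]_n) (df : 'I_2 -> R) :
  (forall j, differentiable (fun x => f x 0 j : R) a) ->
  (forall j, is_derive a d (fun x => f x 0 j : R) (df j)) ->
  d *m jacobian f a = \row_j df j.
Proof.
move=> diff_f der_f; have diff := differentiable_row2 diff_f.
rewrite -deriveEjacobian // derive_mx; last exact: diff_derivable.
by apply/rowP => j; rewrite !mxE derive_val.
Qed.

(** One differentiation rule per head symbol: the head determines the rule, so the
    search that class resolution would make at every node is avoided. *)
Ltac derive_rules leaf :=
  notypeclasses refine (is_derive_eq _ _);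
  [ repeat lazymatch goal with
    | |- is_derive _ _ (_ + _) _ => notypeclasses refine (is_deriveD _ _)
    | |- is_derive _ _ (- _) _ => notypeclasses refine (is_deriveN _)
    | |- is_derive _ _ (_ * _) _ => notypeclasses refine (is_deriveM _ _)
    | |- is_derive _ _ (_ ^+ _) _ => notypeclasses refine (is_deriveX _ _)
    | |- is_derive _ _ (cst _) _ => exact: is_derive_cst
    | |- is_derive _ _ _ _ => leaf
    end
  | rewrite /GRing.scale /= !fctE ].

Ltac diff_poly coords := repeat first
  [ exact: differentiable_cst | apply: differentiableD | apply: differentiableN
  | apply: differentiableM | apply: differentiableX | exact: coords ].

Lemma mul_Qh (R : realType) (S : method R) (h d : 'rV[R]_2) (v : 'rV[R]_5) :
  d *m Qh S h v = \row_j nth 0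
    [:: (3 * grav S * h 0 0 ^+ 2
         + 2 * (grav S * (h 0 1 + v 0 i4) - v 0 i0) * h 0 0) * d 0 0
        + grav S * h 0 0 ^+ 2 * d 0 1;
        grav S * density_ratio S * h 0 1 ^+ 2 * d 0 0
        + (3 * grav S * h 0 1 ^+ 2
           + 2 * (grav S * (density_ratio S * h 0 0 + v 0 i4) - v 0 i2) * h 0 1)
          * d 0 1] j.
Proof.
pose c := fun (i : 'I_2) (h : 'rV[R]_2) => h 0 i : R.
have dc i : differentiable (c i) h by exact: differentiable_coord.
have hc i : is_derive h d (c i) (d 0 i) by exact: is_derive_coord.
pose q1 : 'rV[R]_2 -> R := cst (grav S) * c 0 ^+ 3
  + (cst (grav S) * (c 1 + cst (v 0 i4)) - cst (v 0 i0)) * c 0 ^+ 2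
  + cst (v 0 i1 ^+ 2 / 2).
pose q2 : 'rV[R]_2 -> R := cst (grav S) * c 1 ^+ 3
  + (cst (grav S) * (cst (density_ratio S) * c 0 + cst (v 0 i4)) - cst (v 0 i2))
    * c 1 ^+ 2
  + cst (v 0 i3 ^+ 2 / 2).
have E1 : (fun x => Q S x v 0 0 : R) = q1 by apply/funext => x; rewrite !mxE.
have E2 : (fun x => Q S x v 0 1 : R) = q2 by apply/funext => x; rewrite !mxE.
apply: mul_jacobian_coord => -[[|[|//]] hj].
- by rewrite (_ : Ordinal hj = 0) ?E1 /q1; [diff_poly dc | exact: val_inj].
- by rewrite (_ : Ordinal hj = 1) ?E2 /q2; [diff_poly dc | exact: val_inj].
- rewrite (_ : Ordinal hj = 0) ?E1 /q1; last exact: val_inj.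
  by derive_rules ltac:(exact: hc); rewrite /c; ring.
- rewrite (_ : Ordinal hj = 1) ?E2 /q2; last exact: val_inj.
  by derive_rules ltac:(exact: hc); rewrite /c; ring.
Qed.

Lemma mul_Qv (R : realType) (S : method R) (h : 'rV[R]_2) (v w : 'rV[R]_5) :
  w *m Qv S h v = \row_j nth 0
    [:: h 0 0 ^+ 2 * (grav S * w 0 i4 - w 0 i0) + v 0 i1 * w 0 i1;
        h 0 1 ^+ 2 * (grav S * w 0 i4 - w 0 i2) + v 0 i3 * w 0 i3] j.
Proof.
pose c := fun (i : 'I_5) (h : 'rV[R]_5) => h 0 i : R.
have dc i : differentiable (c i) v by exact: differentiable_coord.
have hc i : is_derive v w (c i) (w 0 i) by exact: is_derive_coord.
pose q1 : 'rV[R]_5 -> R := cst (grav S * h 0 0 ^+ 3)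
  + (cst (grav S) * (cst (h 0 1) + c i4) - c i0) * cst (h 0 0 ^+ 2)
  + c i1 ^+ 2 * cst 2^-1.
pose q2 : 'rV[R]_5 -> R := cst (grav S * h 0 1 ^+ 3)
  + (cst (grav S) * (cst (density_ratio S * h 0 0) + c i4) - c i2)
    * cst (h 0 1 ^+ 2)
  + c i3 ^+ 2 * cst 2^-1.
have E1 : (fun x => Q S h x 0 0 : R) = q1 by apply/funext => x; rewrite !mxE.
have E2 : (fun x => Q S h x 0 1 : R) = q2 by apply/funext => x; rewrite !mxE.
apply: mul_jacobian_coord => -[[|[|//]] hj].
- by rewrite (_ : Ordinal hj = 0) ?E1 /q1; [diff_poly dc | exact: val_inj].
- by rewrite (_ : Ordinal hj = 1) ?E2 /q2; [diff_poly dc | exact: val_inj].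
- rewrite (_ : Ordinal hj = 0) ?E1 /q1; last exact: val_inj.
  by derive_rules ltac:(exact: hc); rewrite /c; field.
- rewrite (_ : Ordinal hj = 1) ?E2 /q2; last exact: val_inj.
  by derive_rules ltac:(exact: hc); rewrite /c; field.
Qed.

Lemma QhE (R : realType) (S : method R) (h : 'rV[R]_2) (v : 'rV[R]_5) :
  [/\ Qh S h v 0 0 = 3 * grav S * h 0 0 ^+ 2
        + 2 * (grav S * (h 0 1 + v 0 i4) - v 0 i0) * h 0 0,
      Qh S h v 1 0 = grav S * h 0 0 ^+ 2,
      Qh S h v 0 1 = grav S * density_ratio S * h 0 1 ^+ 2 &
      Qh S h v 1 1 = 3 * grav S * h 0 1 ^+ 2
        + 2 * (grav S * (density_ratio S * h 0 0 + v 0 i4) - v 0 i2) * h 0 1].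
Proof.
have E i j : Qh S h v i j = row i (Qh S h v) 0 j by rewrite [RHS]mxE.
by split; rewrite E rowE mul_Qh !mxE /= ?mulr1 ?mulr0 ?addr0 ?add0r.
Qed.

Lemma Qh_det_neq0 (R : realType) (S : method R) (h : 'rV[R]_2) (v : 'rV[R]_5) :
  Qh S h v \in unitmx ->
  Qh S h v 0 0 * Qh S h v 1 1 - Qh S h v 1 0 * Qh S h v 0 1 != 0.
Proof.
rewrite unitmxE unitfE (expand_det_row _ 0) !big_ord_recl big_ord0 /cofactor.
rewrite !det_mx11 !mxE /= addr0 expr0 mul1r expr1 mulN1r.
have -> : lift ord0 ord0 = 1 :> 'I_2 by exact: val_inj.
have -> : lift 1 0 = 0 :> 'I_2 by exact: val_inj.
by rewrite mulrN [X in _ - X]mulrC.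
Qed.

(** The linearised equations Q_h dh + Q_v w = 0 satisfied by the derivative dh of
    the heights in the direction w. *)
Lemma dheight_eq (R : realType) (S : method R) (v w : 'rV[R]_5) :
  Qh S (height S v) v \in unitmx ->
  w *m dheight S v *m Qh S (height S v) v + w *m Qv S (height S v) v = 0.
Proof.
by move=> U; rewrite /dheight mulmxA mulmxKV // mulmxN addNr.
Qed.

(** * Limits through Cramer's rule *)

(** The unknowns X and Y solve a linear system whose data converge to those of a
    regular limit system; Cramer's rule writes them as continuous functions of
    these data, so they converge too. *)
Lemma cramer_cvg_fst (R : realType) (T : Type) (F : set_system T) {FF : Filter F}
    (p11 p12 p21 p22 q1 q2 X Y : T -> R) (a11 a12 a21 a22 b1 b2 x y : R) :
  p11 @ F --> a11 -> p12 @ F --> a12 -> p21 @ F --> a21 -> p22 @ F --> a22 ->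
  q1 @ F --> b1 -> q2 @ F --> b2 ->
  a11 * a22 - a12 * a21 != 0 ->
  a11 * x + a12 * y + b1 = 0 -> a21 * x + a22 * y + b2 = 0 ->
  (\forall t \near F, p11 t * X t + p12 t * Y t + q1 t = 0) ->
  (\forall t \near F, p21 t * X t + p22 t * Y t + q2 t = 0) ->
  X @ F --> x.
Proof.
move=> c11 c12 c21 c22 d1 d2 det0 e1 e2 E1 E2.
pose D t := p11 t * p22 t - p12 t * p21 t.
have cD : D @ F --> a11 * a22 - a12 * a21 by apply: cvgB; apply: cvgM.
have nD : \forall t \near F, D t != 0 by exact: cvgr_neq0 cD det0.
have -> : x = (a12 * b2 - a22 * b1) / (a11 * a22 - a12 * a21).
  apply: (mulIf det0); rewrite divfK //; apply/eqP; rewrite -subr_eq0.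
  have <- : a22 * (a11 * x + a12 * y + b1) - a12 * (a21 * x + a22 * y + b2) = 0.
    by rewrite e1 e2 !mulr0 subrr.
  by apply/eqP; ring.
apply: (@cvg_trans _ ((fun t => (p12 t * q2 t - p22 t * q1 t) * (D t)^-1) @ F)).
  apply: near_eq_cvg; near=> t.
  have Dt : D t != 0 by near: t.
  have e1t : p11 t * X t + p12 t * Y t + q1 t = 0 by near: t.
  have e2t : p21 t * X t + p22 t * Y t + q2 t = 0 by near: t.
  apply: (mulIf Dt); rewrite divfK //; apply/eqP; rewrite -subr_eq0.
  have <- : p12 t * (p21 t * X t + p22 t * Y t + q2 t)
    - p22 t * (p11 t * X t + p12 t * Y t + q1 t) = 0.
    by rewrite e1t e2t !mulr0 subrr.
  by apply/eqP; rewrite /D; ring.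
by apply: cvgM; [apply: cvgB; apply: cvgM | apply: cvgV].
Unshelve. all: by end_near. Qed.

(** Both difference quotients and the derivatives themselves are such unknowns,
    which is why the filter is arbitrary. *)
Lemma cramer_cvg (R : realType) (T : Type) (F : set_system T) {FF : Filter F}
    (p11 p12 p21 p22 q1 q2 X Y : T -> R) (a11 a12 a21 a22 b1 b2 x y : R) :
  p11 @ F --> a11 -> p12 @ F --> a12 -> p21 @ F --> a21 -> p22 @ F --> a22 ->
  q1 @ F --> b1 -> q2 @ F --> b2 ->
  a11 * a22 - a12 * a21 != 0 ->
  a11 * x + a12 * y + b1 = 0 -> a21 * x + a22 * y + b2 = 0 ->
  (\forall t \near F, p11 t * X t + p12 t * Y t + q1 t = 0) ->
  (\forall t \near F, p21 t * X t + p22 t * Y t + q2 t = 0) ->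
  X @ F --> x /\ Y @ F --> y.
Proof.
move=> c11 c12 c21 c22 d1 d2 det0 e1 e2 E1 E2; split.
  exact: (cramer_cvg_fst c11 c12 c21 c22 d1 d2 det0 e1 e2 E1 E2).
apply: (cramer_cvg_fst c12 c11 c22 c21 d1 d2 (x := y) (y := x)).
- by rewrite -oppr_eq0 opprB.
- by rewrite -[RHS]e1 [a12 * _ + _]addrC.
- by rewrite -[RHS]e2 [a22 * _ + _]addrC.
- by apply: filterS E1 => t <-; rewrite [p12 t * _ + _]addrC.
- by apply: filterS E2 => t <-; rewrite [p22 t * _ + _]addrC.
Qed.

Lemma cvg_sqr (R : realType) (T : Type) (F : set_system T) {FF : Filter F}
    (f : T -> R) (l : R) :
  f @ F --> l -> f x ^+ 2 @[x --> F] --> l ^+ 2.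
Proof. by move=> fl; exact: (cvgM fl fl). Qed.

Ltac cvg_rules := repeat lazymatch goal with
  | |- cvg_to _ (nbhs (_ + _)) => apply: cvgD
  | |- cvg_to _ (nbhs (- _)) => apply: cvgN
  | |- cvg_to _ (nbhs (_ * _)) => apply: cvgM
  | |- cvg_to _ (nbhs (_ ^+ _)) => apply: cvg_sqr
  | |- _ => first [ assumption | exact: cvg_cst ]
  end.

(** * The equilibrium inside one cell *)

Section EquilibriumCell.
Context (R : realType) (S : method R) (D : set 'rV[R]_5).
Context (hinv : inverse_transform S D).
Context (a b : R) (ab : a < b).
Context (p : 'rV[{poly R}]_5) (E1 m1 E2 m2 : R).
Context (hp : [/\ p 0 i0 = E1%:P, p 0 i1 = m1%:P, p 0 i2 = E2%:P & p 0 i3 = m2%:P]).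
Context (hD : forall x, `[a, b]%classic x -> D (ev p x)).

(* The heights, the bottom and their derivatives along the cell; [s1] and [s2]
   are the derivatives of the heights as computed by the method. *)
Let g := grav S.
Let r := density_ratio S.
Let h1 (x : R) : R := height S (ev p x) 0 0.
Let h2 (x : R) : R := height S (ev p x) 0 1.
Let bot (x : R) : R := (p 0 i4).[x].
Let bot' (x : R) : R := (p 0 i4)^`().[x].
Let slope (x : R) : 'rV[R]_2 := ev (dpoly p) x *m dheight S (ev p x).
Let s1 (x : R) : R := slope x 0 0.
Let s2 (x : R) : R := slope x 0 1.
Let within_ab (x : R) := within `[a, b]%classic (nbhs x).

Lemma evE (x : R) :
  [/\ ev p x 0 i0 = E1, ev p x 0 i1 = m1, ev p x 0 i2 = E2, ev p x 0 i3 = m2 &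
      ev p x 0 i4 = bot x].
Proof. by case: hp => e0 e1 e2 e3; rewrite !mxE e0 e1 e2 e3 !hornerC. Qed.

Lemma ev_dpolyE (x : R) :
  [/\ ev (dpoly p) x 0 i0 = 0, ev (dpoly p) x 0 i1 = 0, ev (dpoly p) x 0 i2 = 0,
      ev (dpoly p) x 0 i3 = 0 & ev (dpoly p) x 0 i4 = bot' x].
Proof. by case: hp => e0 e1 e2 e3; rewrite !mxE e0 e1 e2 e3 !derivC !horner0. Qed.

Lemma h_gt0 (x : R) : `[a, b]%classic x -> 0 < h1 x /\ 0 < h2 x.
Proof. by move=> /hD /hinv.2 []. Qed.

Lemma heights_solve (x : R) : `[a, b]%classic x ->
  g * h1 x ^+ 3 + (g * (h2 x + bot x) - E1) * h1 x ^+ 2 + m1 ^+ 2 / 2 = 0 /\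
  g * h2 x ^+ 3 + (g * (r * h1 x + bot x) - E2) * h2 x ^+ 2 + m2 ^+ 2 / 2 = 0.
Proof.
move=> /hD /hinv.2 [k1 k2 e _].
have := (equil_consvE k1 k2).1 e; case: hp => e0 e1 e2 e3 q.
have := congr1 (fun w : 'rV_2 => w 0 0) q; have := congr1 (fun w : 'rV_2 => w 0 1) q.
by rewrite !mxE /= e0 e1 e2 e3 !hornerC.
Qed.

(* The matrix of the limit system is the transposed Jacobian of Q in the
   heights. *)
Let A11 x := 3 * g * h1 x ^+ 2 + 2 * (g * (h2 x + bot x) - E1) * h1 x.
Let A12 x := g * h1 x ^+ 2.
Let A21 x := g * r * h2 x ^+ 2.
Let A22 x := 3 * g * h2 x ^+ 2 + 2 * (g * (r * h1 x + bot x) - E2) * h2 x.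

Lemma slopes_solve (x : R) : `[a, b]%classic x ->
  A11 x * s1 x + A12 x * s2 x + g * h1 x ^+ 2 * bot' x = 0 /\
  A21 x * s1 x + A22 x * s2 x + g * h2 x ^+ 2 * bot' x = 0.
Proof.
move=> /hD /hinv.2 [_ _ _ U].
have := dheight_eq (ev (dpoly p) x) U; rewrite -/(slope x) /s1 /s2.
move: (slope x) => s; rewrite mul_Qh mul_Qv => q.
have := congr1 (fun w : 'rV_2 => w 0 0) q; have := congr1 (fun w : 'rV_2 => w 0 1) q.
case: hp => e0 e1 e2 e3.
rewrite !mxE /= e0 e1 e2 e3 !derivC !hornerC => f2 f1; split.
- by rewrite -[RHS]f1 /A11 /A12 /h1 /h2 /bot /bot' /g; ring.
- by rewrite -[RHS]f2 /A21 /A22 /h1 /h2 /bot /bot' /g /r; ring.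
Qed.

Lemma slopes_det (x : R) : `[a, b]%classic x -> A11 x * A22 x - A12 x * A21 x != 0.
Proof.
move=> /hD /hinv.2 [_ _ _ U]; have := Qh_det_neq0 U.
have [-> -> -> ->] := QhE S (height S (ev p x)) (ev p x).
by case: (evE x) => -> _ -> _ ->.
Qed.

Lemma heights_continuous :
  {within `[a, b], continuous h1} /\ {within `[a, b], continuous h2}.
Proof.
have cont_ev : continuous (ev p).
  move=> x; apply/differentiable_continuous/derivable1_diffP/derivable_mxP => i j.
  rewrite (_ : (fun x => ev p x i j) = horner (p 0 j)); first exact: derivable_horner.
  by apply/funext => y; rewrite mxE.
have hw x : `[a, b]%classic x ->
    height S \o ev p @ within_ab x --> height S (ev p x).
  move=> xab; have /subspace_continuousP hc := hinv.1.
  have ev_within : ev p @ within_ab x --> within D (nbhs (ev p x)).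
    move=> U /cont_ev V; change (nbhs x (fun y => `[a, b]%classic y -> U (ev p y))).
    change (nbhs x (fun y => D (ev p y) -> U (ev p y))) in V.
    by apply: filterS V => y + yab; apply; exact: hD.
  exact: (cvg_comp _ _ ev_within (hc _ (hD xab))).
split; apply/subspace_continuousP => x xab.
- exact: (cvg_comp _ _ (hw x xab) (@coord_continuous _ _ _ 0 0 (height S (ev p x)))).
- exact: (cvg_comp _ _ (hw x xab) (@coord_continuous _ _ _ 0 1 (height S (ev p x)))).
Qed.

(** The computed derivatives solve a regular linear system with continuous
    coefficients, up to the ends of the cell. *)
Lemma slopes_continuous :
  {within `[a, b], continuous s1} /\ {within `[a, b], continuous s2}.
Proof.
have [/subspace_continuousP c1 /subspace_continuousP c2] := heights_continuous.
have within_horner (q : {poly R}) x : horner q @ within_ab x --> q.[x].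
  by apply: cvg_within_filter; exact: continuous_horner.
suff H x : `[a, b]%classic x ->
    s1 @ within_ab x --> s1 x /\ s2 @ within_ab x --> s2 x.
  by split; apply/subspace_continuousP => x /H [].
move=> xab; have [{}c1 {}c2] := (c1 x xab, c2 x xab).
have [z1 z2] := slopes_solve xab.
have cb : bot @ within_ab x --> bot x by exact: within_horner.
have cb' : bot' @ within_ab x --> bot' x by exact: within_horner.
apply: (@cramer_cvg _ _ _ _ A11 A12 A21 A22 (fun y => g * h1 y ^+ 2 * bot' y)
  (fun y => g * h2 y ^+ 2 * bot' y)
  _ _ _ _ _ _ _ _ _ _ _ _ _ _ _ _ (slopes_det xab) z1 z2).
1-6: rewrite /A11 /A12 /A21 /A22; cvg_rules.
1-2: by near=> y; have [] : _ /\ _ := @slopes_solve y _;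
  [near: y; exact: withinT |].
Unshelve. all: by end_near. Qed.

(** The implicit function theorem along the bottom profile: the difference
    quotients of the heights solve a linear system whose coefficients converge
    because the branch is continuous. *)
Lemma is_derive_heights (x : R) : x \in `]a, b[ ->
  is_derive x 1 h1 (s1 x) /\ is_derive x 1 h2 (s2 x).
Proof.
move=> xab; have xab' : `[a, b]%classic x by exact: subset_itv_oo_cc.
pose y (t : R) := t *: 1 + x.
have cy : y @ 0^' --> x.
  apply: cvg_within_filter; have -> : x = 0 *: 1 + x by rewrite scale0r add0r.
  by apply: cvgD; [exact: scalel_continuous | exact: cvg_cst].
have [/continuous_within_itvP - /(_ ab) [c1 _ _]
  /continuous_within_itvP - /(_ ab) [c2 _ _]] := heights_continuous.
have ch1 : h1 \o y @ 0^' --> h1 x by exact: cvg_comp cy (c1 _ xab).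
have ch2 : h2 \o y @ 0^' --> h2 x by exact: cvg_comp cy (c2 _ xab).
have cq : (fun t => t^-1 *: (bot (y t) - bot x)) @ 0^' --> bot' x.
  by have [d e] := is_derive_poly (p 0 i4) x; rewrite -[bot' x]e; exact: d.
have near_ab : \forall t \near 0^', `[a, b]%classic (y t).
  have N : nbhs x `[a, b]%classic.
    by apply: filterS (near_in_itvoo xab) => z; exact: subset_itv_oo_cc.
  exact: (cy _ N).
have [z1 z2] := slopes_solve xab'.
have [w1 w2] := heights_solve xab'.
have [d1 d2] : (fun t => t^-1 *: (h1 (y t) - h1 x)) @ 0^' --> s1 x /\
    (fun t => t^-1 *: (h2 (y t) - h2 x)) @ 0^' --> s2 x.
  (* The coefficients come from factoring k - h out of Q (k, ...) - Q (h, ...):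
     cubes and squares are divided by k - h, and the cross terms are attached to
     the square of the new height k. *)
  apply: (@cramer_cvg _ _ _ _
    (fun t => g * (h1 (y t) ^+ 2 + h1 (y t) * h1 x + h1 x ^+ 2)
      + (g * (h2 x + bot x) - E1) * (h1 (y t) + h1 x))
    (fun t => g * h1 (y t) ^+ 2)
    (fun t => g * r * h2 (y t) ^+ 2)
    (fun t => g * (h2 (y t) ^+ 2 + h2 (y t) * h2 x + h2 x ^+ 2)
      + (g * (r * h1 x + bot x) - E2) * (h2 (y t) + h2 x))
    (fun t => g * h1 (y t) ^+ 2 * (t^-1 *: (bot (y t) - bot x)))
    (fun t => g * h2 (y t) ^+ 2 * (t^-1 *: (bot (y t) - bot x)))
    _ _ _ _ _ _ _ _ _ _ _ _ _ _ _ _ (slopes_det xab') z1 z2).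
  - rewrite (_ : A11 x = g * (h1 x ^+ 2 + h1 x * h1 x + h1 x ^+ 2)
      + (g * (h2 x + bot x) - E1) * (h1 x + h1 x)); first by cvg_rules.
    by rewrite /A11; ring.
  - by rewrite /A12 /A21; cvg_rules.
  - by rewrite /A12 /A21; cvg_rules.
  - rewrite (_ : A22 x = g * (h2 x ^+ 2 + h2 x * h2 x + h2 x ^+ 2)
      + (g * (r * h1 x + bot x) - E2) * (h2 x + h2 x)); first by cvg_rules.
    by rewrite /A22; ring.
  - by rewrite /A12 /A21; cvg_rules.
  - by rewrite /A12 /A21; cvg_rules.
  - apply: filterS near_ab => t /heights_solve [u1 u2].
    (* The equation at y t minus the equation at x, divided by t. *)
    rewrite /GRing.scale /=.
    have /= := congr2 (fun v w => t^-1 * (v - w)) u1 w1.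
    by rewrite subrr mulr0 => <-; ring.
  - apply: filterS near_ab => t /heights_solve [u1 u2].
    rewrite /GRing.scale /=.
    have /= := congr2 (fun v w => t^-1 * (v - w)) u2 w2.
    by rewrite subrr mulr0 => <-; ring.
by split; apply: DeriveDef;
  [exact: cvgP d1 | exact: cvg_lim d1 | exact: cvgP d2 | exact: cvg_lim d2].
Qed.

Lemma fluxE (x : R) (q : 'rV[R]_5) :
  dot (flux S (consv S (ev p x))) q = m1 * q 0 i0
    + (m1 ^+ 2 * (h1 x)^-1 + g * h1 x ^+ 2 * 2^-1) * q 0 i1
    + m2 * q 0 i2 + (m2 ^+ 2 * (h2 x)^-1 + g * h2 x ^+ 2 * 2^-1) * q 0 i3.
Proof.
have [_ e1 _ e3 _] := evE x.
have [u0 u1 u2 u3 _] := row5E (h1 x) (ev p x 0 i1) (h2 x) (ev p x 0 i3) (ev p x 0 i4).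
by rewrite dot_row5 u0 u1 u2 u3 e1 e3 mul0r addr0.
Qed.

Lemma sourceE (x : R) (q : 'rV[R]_5) :
  dot (dconsv S (ev p x) (ev (dpoly p) x) *m (Gmx S (consv S (ev p x)))^T) q =
    g * h1 x * (s2 x + bot' x) * q 0 i1
    + (g * r * h2 x * s1 x + g * h2 x * bot' x) * q 0 i3.
Proof.
have [_ d1 _ d3 d4] := ev_dpolyE x.
have [u0 _ u2 _ _] := row5E (h1 x) (ev p x 0 i1) (h2 x) (ev p x 0 i3) (ev p x 0 i4).
have [w0 _ w2 _ w4] := row5E (s1 x) (ev (dpoly p) x 0 i1) (s2 x)
  (ev (dpoly p) x 0 i3) (ev (dpoly p) x 0 i4).
rewrite mul_Gmx dot_row5 u0 u2 w0 w2 w4 d4 /g /r.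
by rewrite !mul0r addr0 add0r addr0.
Qed.

(** The pointwise balance f(u)_x + G(u) u_x = 0: the left side is L(u) applied to
    the derivative of (E1, m1, E2, m2, 0), which is constant on the cell. *)
Lemma is_derive_flux (x : R) (q : 'rV[{poly R}]_5) : x \in `]a, b[ ->
  is_derive x 1 (fun y => dot (flux S (consv S (ev p y))) (ev q y))
    (dot (flux S (consv S (ev p x))) (ev (dpoly q) x)
     - dot (dconsv S (ev p x) (ev (dpoly p) x) *m (Gmx S (consv S (ev p x)))^T)
           (ev q x)).
Proof.
move=> xab; have xab' : `[a, b]%classic x by exact: subset_itv_oo_cc.
have [k1 k2] := is_derive_heights xab.
have [n1 n2] : h1 x != 0 /\ h2 x != 0.
  by have [z1 z2] := h_gt0 xab'; rewrite !lt0r_neq0.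
have [z1 z2] := slopes_solve xab'.
have [w1 w2] := heights_solve xab'.
have dq i := is_derive_poly (q 0 i) x.
have kV1 := is_deriveV n1 k1.
have kV2 := is_deriveV n2 k2.
pose iv1 := fun y => (h1 y)^-1.
pose iv2 := fun y => (h2 y)^-1.
have -> : (fun y => dot (flux S (consv S (ev p y))) (ev q y)) =
   cst m1 * horner (q 0 i0)
   + (cst (m1 ^+ 2) * iv1 + cst g * h1 ^+ 2 * cst 2^-1) * horner (q 0 i1)
   + cst m2 * horner (q 0 i2)
   + (cst (m2 ^+ 2) * iv2 + cst g * h2 ^+ 2 * cst 2^-1) * horner (q 0 i3).
  by apply/funext => y; rewrite fluxE !mxE.
derive_rules ltac:(first
  [exact: dq | exact: k1 | exact: k2 | exact: kV1 | exact: kV2]).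
rewrite fluxE sourceE !mxE /iv1 /iv2.
(* In each layer the momentum flux balances the source.  This is the linearised
   equation Q = 0 divided by h, from which Q = 0 itself removes the energy. *)
have f1 : (- m1 ^+ 2 * (h1 x) ^- 2 + g * h1 x) * s1 x
    + g * h1 x * (s2 x + bot' x) = 0.
  have /= := congr2 (fun u v => (u - 2 / h1 x * s1 x * v) / h1 x) z1 w1.
  by rewrite mulr0 subr0 mul0r => <-; rewrite /A11 /A12; field.
have f2 : (- m2 ^+ 2 * (h2 x) ^- 2 + g * h2 x) * s2 x
    + (g * r * h2 x * s1 x + g * h2 x * bot' x) = 0.
  have /= := congr2 (fun u v => (u - 2 / h2 x * s2 x * v) / h2 x) z2 w2.
  by rewrite mulr0 subr0 mul0r => <-; rewrite /A21 /A22; field.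
apply/eqP; rewrite -subr_eq0; apply/eqP.
transitivity (
  ((- m1 ^+ 2 * (h1 x) ^- 2 + g * h1 x) * s1 x + g * h1 x * (s2 x + bot' x))
    * (q 0 i1).[x]
  + ((- m2 ^+ 2 * (h2 x) ^- 2 + g * h2 x) * s2 x
     + (g * r * h2 x * s1 x + g * h2 x * bot' x)) * (q 0 i3).[x]).
  by field; apply/andP.
by rewrite f1 f2 !mul0r addr0.
Qed.

(** The fundamental theorem of calculus for f(u) . phi; continuity on the closed
    cell makes the two integrands separately integrable. *)
Lemma cell_balance (q : 'rV[{poly R}]_5) :
  \int[lebesgue_measure]_(x in `[a, b])
    dot (flux S (consv S (ev p x))) (ev (dpoly q) x)
  - \int[lebesgue_measure]_(x in `[a, b])
    dot (dconsv S (ev p x) (ev (dpoly p) x) *m (Gmx S (consv S (ev p x)))^T)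
      (ev q x) =
  dot (flux S (consv S (ev p b))) (ev q b)
  - dot (flux S (consv S (ev p a))) (ev q a).
Proof.
have [/subspace_continuousP ch1 /subspace_continuousP ch2] := heights_continuous.
have [/subspace_continuousP cs1 /subspace_continuousP cs2] := slopes_continuous.
have within_horner (f : {poly R}) x : horner f @ within_ab x --> f.[x].
  by apply: cvg_within_filter; exact: continuous_horner.
have cflux (f : 'rV[{poly R}]_5) : {within `[a, b],
    continuous (fun x => dot (flux S (consv S (ev p x))) (ev f x))}.
  rewrite (_ : (fun x => _) = (fun x => m1 * (f 0 i0).[x]
    + (m1 ^+ 2 * (h1 x)^-1 + g * h1 x ^+ 2 * 2^-1) * (f 0 i1).[x]
    + m2 * (f 0 i2).[x]
    + (m2 ^+ 2 * (h2 x)^-1 + g * h2 x ^+ 2 * 2^-1) * (f 0 i3).[x])); last first.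
    by apply/funext => x; rewrite fluxE !mxE.
  apply/subspace_continuousP => x xab.
  have [{}ch1 {}ch2] := (ch1 x xab, ch2 x xab).
  have [k1 k2] := h_gt0 xab.
  have ch1V : (fun y => (h1 y)^-1) @ within_ab x --> (h1 x)^-1.
    by apply: cvgV => //; exact: lt0r_neq0.
  have ch2V : (fun y => (h2 y)^-1) @ within_ab x --> (h2 x)^-1.
    by apply: cvgV => //; exact: lt0r_neq0.
  have [[[cf0 cf1] cf2] cf3] := (within_horner (f 0 i0) x, within_horner (f 0 i1) x,
    within_horner (f 0 i2) x, within_horner (f 0 i3) x).
  by rewrite /from_subspace; cbv beta; cvg_rules.
have csource : {within `[a, b], continuous (fun x => dot (dconsv S (ev p x)
    (ev (dpoly p) x) *m (Gmx S (consv S (ev p x)))^T) (ev q x))}.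
  rewrite (_ : (fun x => _) = (fun x => g * h1 x * (s2 x + bot' x) * (q 0 i1).[x]
    + (g * r * h2 x * s1 x + g * h2 x * bot' x) * (q 0 i3).[x])); last first.
    by apply/funext => x; rewrite sourceE !mxE.
  apply/subspace_continuousP => x xab.
  have [{}ch1 {}ch2] := (ch1 x xab, ch2 x xab).
  have [{}cs1 {}cs2] := (cs1 x xab, cs2 x xab).
  have [cf1 cf3] := (within_horner (q 0 i1) x, within_horner (q 0 i3) x).
  have cb' : bot' @ within_ab x --> bot' x by exact: within_horner.
  by rewrite /from_subspace; cbv beta; cvg_rules.
have segm := @segment_compact R a b.
rewrite -RintegralB //; first last.
- exact: continuous_compact_integrable.
- exact: continuous_compact_integrable.
have [_ cFa cFb] := (continuous_within_itvP _ ab).1 (cflux q).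
rewrite /Rintegral (@continuous_FTC2 _ _
  (fun x => dot (flux S (consv S (ev p x))) (ev q x))) //.
- apply/subspace_continuousP => x xab; apply: cvgB.
    by have /subspace_continuousP := cflux (dpoly q); apply.
  by have /subspace_continuousP := csource; apply.
- by split => // x xab; have [] := is_derive_flux q xab.
- by move=> x xab; rewrite derive1E; have [] := is_derive_flux q xab.
Qed.

End EquilibriumCell.

(** * The spatial operator vanishes *)

(** Together with half of the flux jump, the mean flux at a node is the trace of
    the flux from inside the cell, whichever side of the node the cell is on. *)
Lemma face_minus (R : realType) (x y q : 'rV[R]_5) :
  dot (2^-1 *: (x + y)) q + 2^-1 * dot q (x - y) = dot x q.
Proof.
rewrite /dot mulr_sumr -big_split /=; apply: eq_bigr => i _.
by rewrite !mxE; field.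
Qed.

Lemma face_plus (R : realType) (x y q : 'rV[R]_5) :
  dot (2^-1 *: (x + y)) q - 2^-1 * dot q (x - y) = dot y q.
Proof.
rewrite /dot mulr_sumr -sumrB; apply: eq_bigr => i _.
by rewrite !mxE; field.
Qed.

(** The starred state forgets the bottom of the trace it is built from. *)
Lemma star_tilde (R : realType) (S : method R) (w : 'rV[R]_5) (c : R) :
  star S (tilde w) c = star S w c.
Proof.
have [t0 t1 t2 t3 _] := row5E (w 0 i0) (w 0 i1) (w 0 i2) (w 0 i3) 0.
by rewrite /star /tilde t0 t1 t2 t3.
Qed.

Section WellBalanced.
Context (R : realType) (S : method R) (D : set 'rV[R]_5).
Context (v : field5 S) (E1 m1 E2 m2 : R).
Context (hmesh : forall j : 'I_(ncell S), lnode j < rnode j).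
Context (hinv : inverse_transform S D).
Context (hD : forall (j : 'I_(ncell S)) (x : R), cell j x -> D (ev (v j) x)).
Context (heq : moving_water E1 m1 E2 m2 v) (hbc : compatible_bc E1 m1 E2 m2 v).

Lemma tilde_ev (j : 'I_(ncell S)) (x : R) :
  tilde (ev (v j) x) = row5 E1 m1 E2 m2 0.
Proof. by have [e0 e1 e2 e3] := heq j; rewrite /tilde !mxE e0 e1 e2 e3 !hornerC. Qed.

Lemma tilde_traces (i : 'I_(ncell S).+1) :
  tilde (trace_minus v i) = row5 E1 m1 E2 m2 0 /\
  tilde (trace_plus v i) = row5 E1 m1 E2 m2 0.
Proof.
rewrite /trace_minus /trace_plus; have [hL hR] := hbc.
by split; case: unlift => [j|] //; exact: tilde_ev.
Qed.

Lemma star_traces (i : 'I_(ncell S).+1) (c : R) :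
  star S (trace_plus v i) c = star S (trace_minus v i) c.
Proof.
by have [hm hp] := tilde_traces i; rewrite -star_tilde hp -hm star_tilde.
Qed.

Lemma flux_mod_equil (i : 'I_(ncell S).+1) :
  flux_mod v i = 2^-1 *: (flux S (consv S (trace_minus v i))
                          + flux S (consv S (trace_plus v i))).
Proof. by rewrite /flux_mod star_traces subrr scaler0 subr0. Qed.

Lemma path_term_equil (i : 'I_(ncell S).+1) :
  path_term v i = flux S (consv S (trace_minus v i))
                  - flux S (consv S (trace_plus v i)).
Proof.
rewrite /path_term; have [-> ->] := tilde_traces i.
rewrite subrr [X in X - _](_ : _ = 0) ?sub0r 1?addrC //.
apply/rowP => c; rewrite !mxE /path_int.
case: (quad S) => [qs|].
  by rewrite big1 // => ? _; rewrite mul0mx mxE mulr0.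
by rewrite /Rintegral integral0_eq // => x _; rewrite mul0mx mxE.
Qed.

Lemma RHS_equil (phi : field5 S) (j : 'I_(ncell S)) : Defs.RHS v phi j = 0.
Proof.
have bal := cell_balance hinv (hmesh j) (heq j) (@hD j) (phi j).
have tr : trace_minus v (lift ord0 j) = ev (v j) (rnode j).
  by rewrite /trace_minus liftK.
have tl : trace_plus v (lift ord_max j) = ev (v j) (lnode j).
  by rewrite /trace_plus liftK.
have := face_minus (flux S (consv S (trace_minus v (lift ord0 j))))
  (flux S (consv S (trace_plus v (lift ord0 j)))) (ev (phi j) (rnode j)).
have := face_plus (flux S (consv S (trace_minus v (lift ord_max j))))
  (flux S (consv S (trace_plus v (lift ord_max j)))) (ev (phi j) (lnode j)).
rewrite -!flux_mod_equil -!path_term_equil tr tl => fl fr.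
rewrite -fl -fr in bal; rewrite /Defs.RHS /cell_int /cell.
by move/eqP: bal; rewrite -subr_eq0 => /eqP bal; rewrite -[RHS]bal; ring.
Qed.

End WellBalanced.

(** * Newton's method at a solution *)

Section NewtonStages.
Context (R : realType) (S : method R).
Implicit Types (rhs : field5 S -> 'I_(ncell S) -> R) (v w : field5 S).

Lemma newton_stationary rhs j (s : nat -> 'rV[{poly R}]_5) :
  solves_cell rhs j (s 0) -> (forall n, newton_step rhs j (s n) (s n.+1)) ->
  forall n, s n = s 0.
Proof.
move=> s0 step; elim=> // n IH.
by case: (step n) => [[_ ->]//|[]]; rewrite IH.
Qed.

(** A stage equation may have several solutions; the one selected is the limit of
    the Newton sequence, and that sequence is constant. *)
Lemma stage_unique guesses rhs v w :
  (forall w0, guesses w0 -> w0 = v) -> (forall j, solves_cell rhs j (v j)) ->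
  stage guesses rhs w -> w = v.
Proof.
move=> gv sv [_ _ [w0 /gv -> step]]; apply/funext => j.
have [s [s0 step_s lim_s]] := step j.
have sE n : s n = v j.
  by rewrite (newton_stationary _ step_s) s0.
apply/rowP => i; apply/polyP => l.
have lim := lim_s i l.
rewrite (_ : (fun n => _) = (fun=> (v j 0 i)`_l)) in lim; last first.
  by apply/funext => n; rewrite sE.
by apply: (@cvg_unique _ _ _ _ _ _ lim (cvg_cst _)); exact: Rhausdorff.
Qed.

Lemma stage_refl (guesses : set (field5 S)) rhs v :
  inV v -> guesses v -> (forall j, solves_cell rhs j (v j)) -> stage guesses rhs v.
Proof.
move=> hV gv sv; split=> //; exists v => // j; exists (fun=> v j); split=> //.
- by left.
- by move=> i l; exact: cvg_cst.
Qed.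
End NewtonStages.

Theorem theorem4p2 (R : realType) (S : method R) (D : set 'rV[R]_5)
    (v0 : field5 S) (E1 m1 E2 m2 : R)
    (hg : 0 < grav S) (hr : 0 < density_ratio S < 1) (hdt : 0 < dt S)
    (hmesh : forall j : 'I_(ncell S), lnode j < rnode j)
    (hinv : inverse_transform S D)
    (hV : inV v0)
    (hD : forall (j : 'I_(ncell S)) (x : R), cell j x -> D (ev (v0 j) x))
    (heq : moving_water E1 m1 E2 m2 v0)
    (hbc : compatible_bc E1 m1 E2 m2 v0) :
  rk3_step v0 v0 /\
  forall v : nat -> field5 S,
    v 0%N = v0 -> (forall n, rk3_step (v n) (v n.+1)) ->
    forall n, v n = v0.
Proof.
have rhs0 phi j : Defs.RHS v0 phi j = 0.
  exact: (RHS_equil hmesh hinv hD heq hbc).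
have solves (k l : R) : k + l = 1 -> forall j, solves_cell (fun phi j =>
    k * mass j (v0 j) phi + l * (mass j (v0 j) phi + dt S * Defs.RHS v0 phi j))
    j (v0 j).
  by move=> kl j phi _; rewrite rhs0 mulr0 addr0 -mulrDl kl mul1r.
have solves1 j : solves_cell (fun phi j =>
    mass j (v0 j) phi + dt S * Defs.RHS v0 phi j) j (v0 j).
  by move=> phi _; rewrite rhs0 mulr0 addr0.
have solves2 := solves (3 / 4) (1 / 4) ltac:(by field).
have solves3 := solves (1 / 3) (2 / 3) ltac:(by field).
split.
  exists v0, v0; split; apply: stage_refl => //=; first by left.
  exact: Or31.
move=> v v_0 step n; elim: n => // n IH.
have [w1 [w2 []]] := step n; rewrite IH.
move=> /(stage_unique (fun _ e => e) solves1) -> st2.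
have e2 : w2 = v0 by apply: stage_unique solves2 st2 => w0 /= [].
move: st2; rewrite e2 => _; apply: stage_unique => //= w0.
by case.
Qed.
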